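(* Let $\mathcal{F}$ be a difference field, let $y$ be a difference indeterminate over $\mathcal{F}$, and let $f\in\mathbb{Z}[x]$ with $\mathrm{lc}(f)>0$. Let $\mathcal{I}_f$ be the difference ideal of $\mathcal{F}\{y\}$ generated by all $y^{h^+}-y^{h^-}$ with $h=fg$, $g\in\mathbb{Z}[x]$, $\mathrm{lc}(g)>0$. Then $\mathcal{I}_f$ has a finite $\sigma$-Gröbner basis, under a monomial order compatible with the $\sigma$-structure, if and only if $f\in\Phi_1$.
   Context: A difference field ($\sigma$-field) is a field $\mathcal{F}$ with an injective ring endomorphism $\sigma$. $\mathcal{F}\{y\}=\mathcal{F}[y,\sigma(y),\sigma^2(y),\dots]$ is the difference polynomial ring, a polynomial ring in infinitely many variables on which $\sigma$ acts. For $p=\sum_{i=0}^s c_ix^i\in\mathbb{N}[x]$ ($\mathbb{N}$ contains $0$) and an element $a$, write $a^p=\prod_{i=0}^s(\sigma^i(a))^{c_i}$; so $a^{x^m}=\sigma^m(a)$, and the monomials of $\mathcal{F}\{y\}$ are exactly the $y^p$ with $p\in\mathbb{N}[x]$. A difference ideal ($\sigma$-ideal) is an ideal $\mathcal{I}$ (possibly infinitely generated) with $\sigma(\mathcal{I})\subset\mathcal{I}$; the $\sigma$-ideal generated by a set is the smallest $\sigma$-ideal containing it. Monomial order: a monomial order on $\mathcal{F}\{y\}$ compatible with the $\sigma$-structure satisfies $y^{x^{k_1}}<y^{x^{k_2}}$ for $k_1<k_2$, and is such that $y^{h^+}>y^{h^-}$ for every $h\in\mathbb{Z}[x]$ with $\mathrm{lc}(h)>0$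 (i.e. it is the lexicographic order with $y<y^x<y^{x^2}<\cdots$). $\mathbf{LM}(P)$ is the largest monomial of $P$. A set $\mathbb{G}\subset\mathcal{I}$ is a $\sigma$-Gröbner basis of a $\sigma$-ideal $\mathcal{I}$ if for every nonzero $P\in\mathcal{I}$ there are $m\in\mathbb{N}$ and $G\in\mathbb{G}$ with $(\mathbf{LM}(G))^{x^m}\mid\mathbf{LM}(P)$. For $h\in\mathbb{Z}[x]$, $\mathrm{lc}(h)$ and $\mathrm{lt}(h)$ denote the leading coefficient and leading term, and $h^+,h^-\in\mathbb{N}[x]$ are the positive and negative parts of $h$, so $h=h^+-h^-$ with no monomial occurring in both. Define $\Phi_0=\{h\in\mathbb{Z}[x]\mid \mathrm{lt}(h)=h^+\}$ and $\Phi_1=\{h\in\mathbb{Z}[x]\mid hg\in\Phi_0\text{ for some monic }g\in\mathbb{Z}[x]\}$. *)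

(* Defs.v *)
From HB Require Import structures.
From mathcomp Require Import all_boot all_order all_algebra.
From mathcomp Require Import finmap monalg.

Set Implicit Arguments.
Unset Strict Implicit.
Unset Printing Implicit Defensive.

Import Order.TTheory GRing.Theory Num.Theory.

Local Open Scope ring_scope.

(* In a monomial m : {cmonom nat}, the value m i is the exponent of
   sigma^i(y). *)
Notation dpoly F := {malg F[{cmonom nat}]}.

Definition mshift (m : {cmonom nat}) : {cmonom nat} :=
  [cmonom m i.-1 | i in [fset j.+1 | j in finsupp m]]%M.

(* The exponent vector of y^p; see dpow_dvar. *)
Definition ymon (p : {poly nat}) : {cmonom nat} :=
  [cmonom (p`_i)%R | i in [fset j | j in iota 0 (size p)]]%M.

Lemma mshiftE m i : mshift m i = if i is j.+1 then m j else 0%N.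
Proof.
rewrite /mshift cmE /= fsfun_fun; case: i => [|j] /=.
  by case: ifPn => // /imfsetP[].
case: ifPn => // /negP jm; apply/esym/eqP; rewrite cmE_eq0.
by apply/negP => jm'; apply: jm; apply/imfsetP; exists j.
Qed.

Lemma ymonE p i : ymon p i = p`_i.
Proof.
rewrite /ymon cmE /= fsfun_fun; case: ifPn => // /negP ip.
rewrite nth_default // leqNgt; apply/negP => lt_i; apply: ip.
by apply/imfsetP; exists i => //=; rewrite mem_iota.
Qed.

Lemma mshift1 : mshift mone = mone.
Proof. by apply/eqP/cmP => -[|i]; rewrite mshiftE !cm1. Qed.

Lemma mshiftM : {morph mshift : m1 m2 / mmul m1 m2}.
Proof.
by move=> m1 m2; apply/eqP/cmP => -[|i]; rewrite ?cmM !mshiftE ?cmM.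
Qed.

Lemma malgU1M (F : fieldType) (m1 m2 : {cmonom nat}) :
  << mmul m1 m2 >> = << m1 >> * << m2 >> :> dpoly F.
Proof. by rewrite malgM_def fgmulUU mulr1. Qed.

Definition mshift_poly (F : fieldType) (m : {cmonom nat}) : dpoly F :=
  << mshift m >>.

Lemma mshift_poly_mmorphism (F : fieldType) : mmorphism (@mshift_poly F).
Proof.
by split=> [m1 m2|]; rewrite /mshift_poly ?mshift1 // mshiftM malgU1M.
Qed.

HB.instance Definition _ (F : fieldType) :=
  isMultiplicative.Build _ _ (@mshift_poly F) (@mshift_poly_mmorphism F).

(* The extension of sigma to F{y}.  A ring morphism between fields is injective,
   so every sigma makes F a difference field. *)
Definition dsigma (F : fieldType) (sigma : {rmorphism F -> F}) :
    dpoly F -> dpoly F :=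
  mmap (@malgC {cmonom nat} F \o sigma) (@mshift_poly F).

HB.instance Definition _ (F : fieldType) (sigma : {rmorphism F -> F}) :=
  GRing.RMorphism.copy (dsigma sigma)
    (mmap (@malgC {cmonom nat} F \o sigma) (@mshift_poly F)).

Definition dvar (F : fieldType) : dpoly F := << ymon 1 >>.

Definition dpow (R : comNzRingType) (s : R -> R) (a : R) (p : {poly nat}) : R :=
  \prod_(i < size p) iter i s a ^+ (p`_i)%R.

Lemma dsigmaC (F : fieldType) (sigma : {rmorphism F -> F}) (c : F) :
  dsigma sigma c%:MP = (sigma c)%:MP.
Proof. by rewrite /dsigma mmapU /= /mshift_poly mshift1 mulr1. Qed.

Lemma dsigmaU (F : fieldType) (sigma : {rmorphism F -> F}) (m : {cmonom nat}) :
  dsigma sigma << m >> = << mshift m >>.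
Proof. by rewrite /dsigma mmapU /= rmorph1 mul1r. Qed.

Lemma dpow_dvar (F : fieldType) (sigma : {rmorphism F -> F}) (p : {poly nat}) :
  dpow (dsigma sigma) (dvar F) p = << ymon p >>.
Proof.
have iterE i : iter i (dsigma sigma) (dvar F) = << ymon 'X^i >>.
  elim: i => [|i IH]; first by rewrite expr0.
  rewrite iterS IH dsigmaU; congr << _ >>; apply/eqP/cmP => -[|j].
    by rewrite mshiftE ymonE coefXn.
  by rewrite mshiftE !ymonE !coefXn eqSS.
have expE m n : << m >> ^+ n = << iter n (mmul m) mone >> :> dpoly F.
  elim: n => [|n IH]; first by rewrite expr0.
  by rewrite exprS IH iterS malgU1M.
have coef_iter n (m : {cmonom nat}) j : iter n (mmul m) mone j = (m j * n)%N.
  by elim: n => [|n IH]; rewrite ?cm1 ?muln0 //= cmM IH mulnS.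
rewrite /dpow; under eq_bigr => i _ do rewrite iterE expE.
have -> (s : seq 'I_(size p)) (g : 'I_(size p) -> {cmonom nat}) :
    \prod_(i <- s) << g i >> = << \big[mmul/mone]_(i <- s) g i >> :> dpoly F.
  by elim/big_rec2: _ => [|i x y _ ->]; rewrite ?malgU1M.
congr << _ >>; apply/eqP/cmP => j; rewrite ymonE.
have -> (s : seq 'I_(size p)) (g : 'I_(size p) -> {cmonom nat}) :
    (\big[mmul/mone]_(i <- s) g i) j = (\sum_(i <- s) g i j)%N.
  by elim/big_rec2: _ => [|i x y _ <-]; rewrite ?cm1 ?cmM.
under eq_bigr => i _ do rewrite coef_iter ymonE coefXn.
have [jp|pj] := ltnP j (size p).
  rewrite (bigD1 (Ordinal jp)) //= eqxx mul1n big1 ?addn0 // => i.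
  by rewrite -val_eqE /= eq_sym => /negPf ->.
rewrite nth_default // big1 // => i _.
by rewrite gtn_eqF // (leq_trans (ltn_ord i)).
Qed.

Definition pos_part (h : {poly int}) : {poly nat} :=
  \poly_(i < size h) (if (0 <= h`_i)%R then `|(h`_i)%R|%N else 0%N).

Definition neg_part (h : {poly int}) : {poly nat} := pos_part (- h).

Definition lead_term (h : {poly int}) : {poly int} :=
  lead_coef h *: 'X^((size h).-1).

Definition Phi0 (h : {poly int}) : Prop :=
  lead_term h = map_poly Posz (pos_part h).

Definition Phi1 (h : {poly int}) : Prop :=
  exists2 g : {poly int}, g \is monic & Phi0 (h * g).

Record sigma_ideal (F : fieldType) (sigma : {rmorphism F -> F})
    (I : dpoly F -> Prop) : Prop := SigmaIdeal {
  sigma_ideal0 : I 0;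
  sigma_idealD : forall P Q, I P -> I Q -> I (P + Q);
  sigma_idealM : forall P Q, I Q -> I (P * Q);
  sigma_ideal_sigma : forall P, I P -> I (dsigma sigma P)
}.

Definition sigma_ideal_gen (F : fieldType) (sigma : {rmorphism F -> F})
    (S : dpoly F -> Prop) (P : dpoly F) : Prop :=
  forall I : dpoly F -> Prop,
    sigma_ideal sigma I -> (forall Q, S Q -> I Q) -> I P.

Definition binom_ideal (F : fieldType) (sigma : {rmorphism F -> F})
    (f : {poly int}) : dpoly F -> Prop :=
  sigma_ideal_gen sigma (fun P => exists2 g : {poly int}, 0 < lead_coef g &
    P = dpow (dsigma sigma) (dvar F) (pos_part (f * g))
        - dpow (dsigma sigma) (dvar F) (neg_part (f * g))).

Record monomial_order (le : rel {cmonom nat}) : Prop := MonomialOrder {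
  monomial_order_total : total le;
  monomial_order_anti : antisymmetric le;
  monomial_order_trans : transitive le;
  monomial_order_mone : forall m, le mone m;
  monomial_order_mmul : forall m m1 m2, le m1 m2 -> le (mmul m m1) (mmul m m2)
}.

Record compatible_order (le : rel {cmonom nat}) : Prop := CompatibleOrder {
  compatible_monomial_order : monomial_order le;
  compatible_var : forall k1 k2, (k1 < k2)%N ->
    le (ymon 'X^k1) (ymon 'X^k2) && (ymon 'X^k1 != ymon 'X^k2);
  compatible_binom : forall h : {poly int}, 0 < lead_coef h ->
    le (ymon (neg_part h)) (ymon (pos_part h))
      && (ymon (neg_part h) != ymon (pos_part h))
}.

(* Relational, so that the zero polynomial has no leading monomial. *)
Definition is_LM (F : fieldType) (le : rel {cmonom nat}) (P : dpoly F)
    (m : {cmonom nat}) : Prop :=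
  m \in msupp P /\ forall m', m' \in msupp P -> le m' m.

Definition mdivides (m1 m2 : {cmonom nat}) : Prop :=
  exists m, m2 = mmul m1 m.

Definition sigma_groebner (F : fieldType) (le : rel {cmonom nat})
    (I G : dpoly F -> Prop) : Prop :=
  (forall P, G P -> I P) /\
  forall P, I P -> P != 0 ->
    exists k Q mQ mP, [/\ G Q, is_LM le Q mQ, is_LM le P mP
                        & mdivides (iter k mshift mQ) mP].

Definition has_finite_sigma_groebner (F : fieldType) (le : rel {cmonom nat})
    (I : dpoly F -> Prop) : Prop :=
  exists s : seq (dpoly F), sigma_groebner le I (fun P => P \in s).

(* The lexicographic order with y < sigma(y) < sigma^2(y) < ...;
   lexm_compatible shows that compatible_order is satisfiable. *)
Definition mpol (m : {cmonom nat}) : {poly int} :=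
  \poly_(i < \max_(j <- finsupp m) j.+1) (m i)%:Z.

Definition lexm : rel {cmonom nat} :=
  fun m1 m2 => 0 <= lead_coef (mpol m2 - mpol m1).

Lemma coef_mpol m i : (mpol m)`_i = (m i)%:Z.
Proof.
rewrite coef_poly; case: ltnP => // le_i; congr Posz.
apply/esym/eqP; rewrite cmE_eq0; apply/negP => im.
by move: le_i; rewrite leqNgt (@leq_bigmax_seq _ _ xpredT succn) //.
Qed.

Lemma mpolM m1 m2 : mpol (mmul m1 m2) = mpol m1 + mpol m2.
Proof. by apply/polyP => i; rewrite coefD !coef_mpol cmM PoszD. Qed.

Lemma mpol_inj : injective mpol.
Proof.
move=> m1 m2 e; apply/eqP/cmP => i.
by have /(congr1 (fun p : {poly int} => p`_i)) := e; rewrite !coef_mpol => -[].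
Qed.

Lemma mpol_binom h : mpol (ymon (pos_part h)) - mpol (ymon (neg_part h)) = h.
Proof.
apply/polyP => i; rewrite coefB !coef_mpol !ymonE !coef_poly size_polyN coefN.
case: ltnP => [_|/(nth_default 0) ->]; last by rewrite subr0.
rewrite oppr_ge0; case: ltrgt0P => [h0|h0|->] //=.
  by rewrite subr0 gtz0_abs.
by rewrite sub0r abszN ltz0_abs // opprK.
Qed.

Lemma lead_coefD_ge0 (p q : {poly int}) :
  0 <= lead_coef p -> 0 <= lead_coef q -> 0 <= lead_coef (p + q).
Proof.
have [->|p_neq0] := eqVneq p 0; first by rewrite add0r.
have [->|q_neq0] := eqVneq q 0; first by rewrite addr0.
case: (ltngtP (size p) (size q)) => [pq|qp|e] p0 q0.
- by rewrite lead_coefDr.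
- by rewrite lead_coefDl.
have lc_gt0 : 0 < lead_coef p + lead_coef q.
  by rewrite addr_gt0 // lt0r lead_coef_eq0 ?p_neq0 ?q_neq0.
have coef_e : (p + q)`_(size p).-1 = lead_coef p + lead_coef q.
  by rewrite coefD !lead_coefE -e.
have size_e : size (p + q) = size p.
  apply/anti_leq/andP; split.
    by rewrite (leq_trans (size_polyD _ _)) // -e maxnn.
  rewrite leqNgt; apply/negP => lt_s; move: lc_gt0.
  rewrite -coef_e nth_default ?ltxx // -ltnS prednK // size_poly_gt0.
  exact: p_neq0.
by rewrite [lead_coef (p + q)]lead_coefE size_e coef_e ltW.
Qed.

Lemma lexm_compatible : compatible_order lexm.
Proof.
have lexm_lt m1 m2 : 0 < lead_coef (mpol m2 - mpol m1) ->
    lexm m1 m2 && (m1 != m2).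
  rewrite /lexm => lt0; rewrite ltW //=; apply/negP => /eqP e.
  by move: lt0; rewrite e subrr lead_coef0 ltxx.
split.
- split.
  + move=> m1 m2; rewrite /lexm -[mpol m2 - _]opprB lead_coefN oppr_ge0.
    exact: le_total.
  + move=> m1 m2; rewrite /lexm -[mpol m2 - _]opprB lead_coefN oppr_ge0.
    move=> /le_anti/eqP; rewrite lead_coef_eq0 subr_eq0.
    by move=> /eqP/mpol_inj.
  + move=> m2 m1 m3; rewrite /lexm => h12 h23.
    by rewrite -(subrKA (mpol m2)) lead_coefD_ge0.
  + move=> m; have mpol1 : mpol mone = 0.
      by apply/polyP => i; rewrite coef_mpol cm1 coef0.
    by rewrite /lexm mpol1 subr0 lead_coefE coef_mpol.
  + by move=> m m1 m2; rewrite /lexm !mpolM opprD addrACA subrr add0r.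
- move=> k1 k2 lt_k; apply: lexm_lt.
  have mpolX k : mpol (ymon 'X^k) = 'X^k.
    by apply/polyP => i; rewrite coef_mpol ymonE !coefXn; case: eqP.
  rewrite !mpolX lead_coefDl ?lead_coefXn //.
  by rewrite size_polyN !size_polyXn ltnS.
- by move=> h h_gt0; apply: lexm_lt; rewrite mpol_binom.
Qed.

(* Main.v *)
(* A compatible order is the lexicographic one, and the leading monomials of I_f
   are exactly the multiples of the y^{h^+} with h in (f) and lc(h) > 0.

   If f g is in Phi_0 with g monic, then (f g)^+ = lc(f) x^d, some shift of which
   divides h^+ as soon as deg h >= d; the h of smaller degree are handled by
   Dickson's lemma.

   Conversely, choosing the coefficients of g from the top down gives, for every
   M, a monic g of degree M such that the coefficients of h = f g in the range
   [deg f, deg f + M) are nonpositive.  Take M at least every i such that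
   sigma^i(y) occurs in a given finite basis.  If a shift of h'^+, with
   h' = f g', divides h^+, then, as deg h' >= deg f, its top term has to land on
   that of h and its other terms land in the range where h^+ vanishes; so f g' is
   in Phi_0, and comparing leading coefficients shows that g' is monic. *)

From HB Require Import structures.
Require Import Defs.
From mathcomp Require Import all_boot all_order all_algebra.
From mathcomp Require Import finmap monalg zify.
From Stdlib Require Import Classical_Prop.

Import Order.TTheory GRing.Theory Num.Theory.

Local Open Scope ring_scope.

(** * Dickson's lemma *)

(** Induction on [d]: take [s0] dominating from below in the first [d] coordinates. It handles every
    [a] whose last coordinate reaches the maximum over [s0]; the others lie in finitely many slices
    of constant last coordinate. *)
Lemma dickson (T : eqType) (c : nat -> T -> nat) d (A : T -> Prop) :
  exists s : seq T, (forall b, b \in s -> A b) /\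
    forall a, A a ->
      exists2 b, b \in s & forall i, (i < d)%N -> (c i b <= c i a)%N.
Proof.
elim: d A => [|d IHd] A.
  have [[a Aa]|noA] := classic (exists a, A a).
    exists [:: a]; split=> [b|a' _]; first by rewrite inE => /eqP ->.
    by exists a; rewrite ?inE.
  by exists [::]; split=> // a Aa; case: noA; exists a.
have [s0 [s0A s0P]] := IHd A.
have slices n : exists s : seq T, (forall b, b \in s -> A b) /\
    forall a, A a -> (c d a < n)%N ->
      exists2 b, b \in s & forall i, (i < d.+1)%N -> (c i b <= c i a)%N.
  elim: n => [|n [s [sA sP]]]; first by exists [::].
  have [s' [s'A s'P]] := IHd (fun a => A a /\ c d a = n).
  exists (s ++ s'); split=> [b|a Aa].
    by rewrite mem_cat => /orP[/sA|/s'A[]].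
  rewrite ltnS leq_eqVlt => /orP[/eqP an|/(sP a Aa)[b bs bP]]; last first.
    by exists b => //; rewrite mem_cat bs.
  have [//|b bs' bP] := s'P a; exists b; first by rewrite mem_cat bs' orbT.
  move=> i; rewrite ltnS leq_eqVlt => /orP[/eqP ->|/bP //].
  by have [_ ->] := s'A b bs'; rewrite an.
have [s [sA sP]] := slices (\max_(b <- s0) c d b)%N.
exists (s0 ++ s); split=> [b|a Aa].
  by rewrite mem_cat => /orP[/s0A|/sA].
have [/(sP a Aa)[b bs bP]|le_a] := ltnP (c d a) (\max_(b <- s0) c d b)%N.
  by exists b => //; rewrite mem_cat bs orbT.
have [b bs bP] := s0P a Aa; exists b; first by rewrite mem_cat bs.
move=> i; rewrite ltnS leq_eqVlt => /orP[/eqP ->|/bP //].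
by apply: leq_trans le_a; apply: (@leq_bigmax_seq _ _ xpredT (c d)).
Qed.

(** * Coefficientwise criteria for [Phi0] and for divisibility *)

Lemma coef_pos_part_le (h : {poly int}) i n :
  (((pos_part h)`_i)%R <= n)%N = (h`_i <= n%:Z).
Proof.
rewrite coef_poly; case: ltnP => [_|/(nth_default 0) -> //].
by case: ifP; lia.
Qed.

Lemma Phi0P (h : {poly int}) :
  Phi0 h <->
  0 <= lead_coef h /\ forall i, (i < (size h).-1)%N -> h`_i <= 0.
Proof.
have coef_lt i : (lead_term h)`_i = if i == (size h).-1 then h`_i else 0.
  by rewrite coefZ coefXn; case: eqP => [->|_]; rewrite ?mulr1 ?mulr0.
split=> [e|[lc0 h0]].
  have {}e i : (if i == (size h).-1 then h`_i else 0) = ((pos_part h)`_i)%R%:Z.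
    by rewrite -coef_lt e coef_map_id0.
  split; first by rewrite lead_coefE; have := e (size h).-1; rewrite eqxx => ->.
  move=> i lt_i; have := e i; rewrite ltn_eqF // => ei.
  by rewrite -(coef_pos_part_le _ _ 0) leqn0 -eqz_nat -ei.
apply/polyP => i; rewrite coef_lt coef_map_id0 //.
case: (ltngtP i (size h).-1) => [/h0|gt_i|e].
- by rewrite -(coef_pos_part_le _ _ 0) leqn0 => /eqP ->.
- have hi: h`_i = 0 by rewrite nth_default // (leq_trans (leqSpred _)).
  have : (((pos_part h)`_i)%R <= 0)%N by rewrite coef_pos_part_le hi.
  by rewrite leqn0 => /eqP ->.
(* For [h = 0] the index [(size h).-1] is not below [size h], so it falls outside the range of
   [pos_part]. *)
have [->|h_neq0] := eqVneq h 0.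
  by rewrite /pos_part size_poly0 poly_def big_ord0 !coef0.
rewrite coef_poly; have -> : (i < size h)%N by rewrite e prednK ?size_poly_gt0.
by move: lc0; rewrite lead_coefE -e => hi0; rewrite hi0 gez0_abs.
Qed.

Lemma mdividesP (m1 m2 : {cmonom nat}) :
  mdivides m1 m2 <-> forall i, (m1 i <= m2 i)%N.
Proof.
split=> [[m ->] i|le_m]; first by rewrite cmM leq_addr.
exists (divcm m2 m1); apply/eqP/cmP => i.
by rewrite cmM divcmE subnKC.
Qed.

Lemma mdivides_shiftP k (m1 m2 : {cmonom nat}) :
  mdivides (iter k mshift m1) m2 <-> forall i, (m1 i <= m2 (k + i)%N)%N.
Proof.
have lo j : (j < k)%N -> iter k mshift m1 j = 0%N.
  by elim: k j => // k IH [|j] jk; rewrite iterS mshiftE // IH.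
have hi i : iter k mshift m1 (k + i)%N = m1 i.
  by elim: k {lo} => // k IH; rewrite iterS addSn mshiftE IH.
split=> [/mdividesP le_m i|le_m]; first by rewrite -hi.
apply/mdividesP => j; have [/lo -> //|/subnKC <-] := ltnP j k.
by rewrite hi.
Qed.

(** The cofactor [m] is the gcd of [m1] and [m2]. Cancelling it extends [compatible_binom] to
    arbitrary pairs of monomials. *)
Lemma mpol_sub_factor {m1 m2 : {cmonom nat}} {h : {poly int}} :
  mpol m2 - mpol m1 = h ->
  exists m, m2 = mmul m (ymon (pos_part h)) /\
            m1 = mmul m (ymon (neg_part h)).
Proof.
move=> e.
have /mdividesP[m m2E] : forall i, (ymon (pos_part h) i <= m2 i)%N.
  move=> i; rewrite ymonE coef_pos_part_le -e coefB !coef_mpol; lia.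
exists m; split; first by rewrite m2E mulmC.
apply: mpol_inj; rewrite mpolM.
have -> : mpol m1 = mpol m2 - h by rewrite -e opprB addrC subrK.
rewrite m2E mpolM -{2}(mpol_binom h) opprB.
by rewrite [_ - mpol (ymon (pos_part h))]addrC addrACA subrr add0r.
Qed.

(** * Compatible orders are lexicographic; leading monomials *)

Section CompatibleOrder.

Context {le : rel {cmonom nat}} (hle : compatible_order le).

Let hmon := compatible_monomial_order hle.

Lemma compatible_refl m : le m m.
Proof. by have := monomial_order_total hmon m m; rewrite orbb. Qed.

Lemma compatible_le {m1 m2} : 0 < lead_coef (mpol m2 - mpol m1) -> le m1 m2.
Proof.
move eq_h: (mpol m2 - mpol m1) => h lc0.
have [m [-> ->]] := mpol_sub_factor eq_h.
by apply: (monomial_order_mmul hmon); have /andP[] := compatible_binom hle lc0.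
Qed.

Lemma compatible_lead_coef_gt0 {m1 m2} :
  le m1 m2 -> m1 != m2 -> 0 < lead_coef (mpol m2 - mpol m1).
Proof.
move=> le12 neq12; have neq0 : mpol m2 - mpol m1 != 0.
  by rewrite subr_eq0 (inj_eq mpol_inj) eq_sym.
rewrite lt0r lead_coef_eq0 neq0 /= leNgt -oppr_gt0 -lead_coefN opprB.
apply/negP => /compatible_le le21.
case/eqP: neq12; apply: (monomial_order_anti hmon).
by rewrite le12 le21.
Qed.

Lemma is_LM_unique {F : fieldType} {P : dpoly F} {m1 m2} :
  is_LM le P m1 -> is_LM le P m2 -> m1 = m2.
Proof.
move=> [P1 le1] [P2 le2]; apply: (monomial_order_anti hmon).
by rewrite le1 ?le2.
Qed.

Lemma is_LM_exists {F : fieldType} {P : dpoly F} :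
  P != 0 -> exists m, is_LM le P m.
Proof.
rewrite -msupp_eq0 => /fset0Pn[m0 m0P].
have max_seq (s : seq {cmonom nat}) : m0 \in s ->
    exists2 m, m \in s & forall m', m' \in s -> le m' m.
  elim: s m0 {m0P} => // a s IH m0 _.
  case: s IH => [_|b s IH].
    exists a; rewrite ?inE // => m'.
    by rewrite inE => /eqP ->; apply: compatible_refl.
  have [|m ms mP] := IH b; first by rewrite inE eqxx.
  have /orP[le_am|le_ma] := monomial_order_total hmon a m.
    exists m; rewrite 1?inE ?ms ?orbT // => m'.
    by rewrite inE => /orP[/eqP->|/mP].
  exists a; rewrite 1?inE ?eqxx // => m'; rewrite inE => /orP[/eqP->|/mP le_m].
    exact: compatible_refl.
  by apply: (monomial_order_trans hmon) le_ma.
by have [m mP leP] := max_seq _ m0P; exists m.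
Qed.

End CompatibleOrder.

(** * Binomials and membership in the ideal *)

Definition ybinom (F : fieldType) (h : {poly int}) : dpoly F :=
  << ymon (pos_part h) >> - << ymon (neg_part h) >>.

Lemma mcoeff_mon {F : fieldType} (m m' : {cmonom nat}) :
  (<< m >> : dpoly F)@_m' = (m == m')%:R.
Proof. by rewrite mcoeffU. Qed.

Lemma mcoeff_ybinom (F : fieldType) (h : {poly int}) m :
  (ybinom F h)@_m =
    (ymon (pos_part h) == m)%:R - (ymon (neg_part h) == m)%:R.
Proof. by rewrite -!mcoeff_mon; apply: mcoeffB. Qed.

Lemma ybinom_LM (F : fieldType) (le : rel {cmonom nat}) (h : {poly int}) :
  compatible_order le -> 0 < lead_coef h ->
  is_LM le (ybinom F h) (ymon (pos_part h)).
Proof.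
move=> hle h0; have /andP[le_np neq_np] := compatible_binom hle h0.
split=> [|m']; rewrite -mcoeff_neq0 mcoeff_ybinom.
  by rewrite eqxx (negPf neq_np) subr0 oner_eq0.
case: (_ =P m') => [<- _|_].
  exact: compatible_refl.
by case: (_ =P m') => [<- //|_]; rewrite subrr eqxx.
Qed.

Lemma ybinom_ideal (F : fieldType) (sigma : {rmorphism F -> F})
    (f g : {poly int}) :
  0 < lead_coef g -> binom_ideal sigma f (ybinom F (f * g)).
Proof.
by move=> g0 I _; apply; exists g; rewrite // !dpow_dvar.
Qed.

(** Membership in the ideal (f) of Z[x]. On [{poly int}], [%|] is divisibility up to a nonzero
    integer factor, so contents are compared separately (Gauss's lemma). The boolean form lets it
    serve as a [pred] in [class_sum]. *)
Definition zdvdp (f h : {poly int}) : bool :=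
  (zprimitive f %| h) && (zcontents f %| zcontents h)%Z.

Lemma zdvdpP (f h : {poly int}) :
  reflect (exists g, h = f * g) (zdvdp f h).
Proof.
apply: (iffP andP) => [[/dvdpP_int[r ->]]|[g ->]]; last first.
  rewrite zcontentsM dvdz_mulr // {2}[f]zpolyEprim -mul_polyC -mulrA.
  by rewrite dvdp_mull ?dvdp_mulr ?dvdpp.
rewrite zprimitive_id zcontentsM zcontents_primitive.
have [->|f_neq0] := eqVneq f 0.
  by move=> _; exists 0; rewrite zprimitive0 !mul0r.
rewrite mul1r dvdz_contents => /polyOverP r_dvd.
exists (map_poly (fun a => (a %/ zcontents f)%Z) r).
rewrite {2}[f]zpolyEprim -scalerAl scalerAr; congr (_ * _).
by apply/polyP => i; rewrite coefZ coef_map_id0 ?div0z // mulrC divzK.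
Qed.

(** These functionals test membership in I_f: they vanish on it when [C] is a union of classes of
    monomials modulo (f). *)
Definition class_sum {F : fieldType} (C : pred {cmonom nat}) : dpoly F -> F :=
  mmap (@idfun F) (fun m => (C m)%:R).

HB.instance Definition _ (F : fieldType) (C : pred {cmonom nat}) :=
  GRing.Additive.copy (@class_sum F C)
    (mmap (@idfun F) (fun m => (C m)%:R)).

Section ClassSum.

Variables (F : fieldType) (sigma : {rmorphism F -> F}) (f : {poly int}).

Let saturated (C : pred {cmonom nat}) :=
  forall m1 m2, zdvdp f (mpol m1 - mpol m2) -> C m1 = C m2.

Lemma class_sumU C c m : class_sum C << c *g m >> = c * (C m)%:R :> F.
Proof. by rewrite /class_sum mmapU. Qed.

Lemma class_sum_mon C m : class_sum C (<< m >> : dpoly F) = (C m)%:R.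
Proof. by rewrite class_sumU mul1r. Qed.

Lemma class_sum_ybinom C (h : {poly int}) :
  class_sum C (ybinom F h) =
    (C (ymon (pos_part h)))%:R - (C (ymon (neg_part h)))%:R.
Proof. by rewrite -!class_sum_mon; apply: (raddfB (class_sum C)). Qed.

Lemma class_sumMU C c m (P : dpoly F) :
  class_sum C (<< c *g m >> * P) = c * class_sum (fun m' => C (mmul m m')) P.
Proof.
rewrite [P]monalgE mulr_sumr !raddf_sum mulr_sumr; apply: eq_bigr => m' _ /=.
by rewrite malgM_def fgmulUU !class_sumU mulrA.
Qed.

Lemma class_sum_dsigma C (P : dpoly F) :
  class_sum C (dsigma sigma P) = sigma (class_sum (C \o mshift) P).
Proof.
rewrite [P]monalgE (raddf_sum (dsigma sigma)) !(raddf_sum (class_sum _)).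
rewrite raddf_sum; apply: eq_bigr => m _ /=.
rewrite /dsigma mmapU /= /mshift_poly malgM_def fgmulUU.
by rewrite mul1m mulr1 !class_sumU rmorphM rmorph_nat.
Qed.

(** The polynomials killed by all saturated class sums form a difference ideal, since multiplying by
    a monomial or applying sigma only pulls [C] back to another saturated set. Both terms of a
    generator lie in one class. *)
Lemma binom_ideal_class_sum {P : dpoly F} :
  binom_ideal sigma f P -> forall C, saturated C -> class_sum C P = 0.
Proof.
move=> /(_ (fun P => forall C, saturated C -> class_sum C P = 0)); apply.
  split=> [C _|P1 P2 P10 P20 C satC|P1 P2 P20 C satC|P1 P10 C satC].
  - exact: raddf0.
  - by rewrite (raddfD (class_sum C)) /= P10 ?P20 ?addr0.
  - rewrite [P1]monalgE mulr_suml (raddf_sum (class_sum C)) big1 // => m _ /=.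
    rewrite class_sumMU P20 ?mulr0 // => m1 m2 dvd12; apply: satC.
    by rewrite !mpolM opprD addrACA subrr add0r.
  (* [mshift] multiplies exponent polynomials by ['X], whence the witness [g * 'X]. *)
  - rewrite class_sum_dsigma P10 ?rmorph0 // => m1 m2 /zdvdpP[g e].
    apply: satC; apply/zdvdpP; exists (g * 'X); rewrite mulrA -e.
    apply/polyP => -[|i]; first by rewrite coefMX coefB !coef_mpol !mshiftE.
    by rewrite coefMX !coefB !coef_mpol !mshiftE.
move=> _ [g _ ->] C satC; rewrite !dpow_dvar -/(ybinom F (f * g)).
rewrite class_sum_ybinom (satC _ (ymon (neg_part (f * g)))) ?subrr //.
rewrite mpol_binom.
by apply/zdvdpP; exists g.
Qed.

(* If m were alone in its class modulo f, the class sum would be its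
   coefficient; so P has a smaller monomial m' with m - m' in (f). *)
Lemma binom_ideal_LM {le : rel {cmonom nat}} {P : dpoly F} {m} :
  compatible_order le -> 0 < lead_coef f ->
  binom_ideal sigma f P -> is_LM le P m ->
  exists2 g : {poly int}, 0 < lead_coef g &
    forall i, (((pos_part (f * g))`_i)%R <= m i)%N.
Proof.
move=> hle f0 PI [mP m_max].
have class0 : class_sum (fun m' => zdvdp f (mpol m - mpol m')) P = 0.
  apply: (binom_ideal_class_sum PI) => m1 m2 /zdvdpP[g e].
  apply/zdvdpP/zdvdpP => -[g' e'].
    by exists (g' + g); rewrite mulrDr -e -e' addrA subrK.
  by exists (g' - g); rewrite mulrBr -e -e' opprB addrA subrK.
have [m' m'P /andP[neq /zdvdpP[g e]]] : exists2 m', m' \in msupp P &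
    (m' != m) && zdvdp f (mpol m - mpol m').
  apply/hasP; apply: contraPT class0 => /hasPn alone.
  rewrite /class_sum mmapE (big_fsetD1 m) //= big1_seq ?addr0 => [|m' /=].
    have -> : zdvdp f (mpol m - mpol m).
      by apply/zdvdpP; exists 0; rewrite subrr mulr0.
    by rewrite mulr1; apply/eqP; rewrite mcoeff_neq0.
  rewrite in_fsetD1 => /andP[neq /alone]; rewrite neq /= => /negPf ->.
  by rewrite mulr0.
have := compatible_lead_coef_gt0 hle (m_max _ m'P) neq.
rewrite e lead_coefM pmulr_rgt0 // => g0; exists g => // i.
by rewrite coef_pos_part_le -e coefB !coef_mpol; lia.
Qed.

End ClassSum.

(** * From a finite basis to [Phi1] *)

(** Passing from [g] to [g * 'X - c] moves the nonpositive range up by one and subtracts [c * f],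
    which leaves degrees above deg f alone; only the coefficient in degree deg f has to be made
    nonpositive. *)
Lemma monic_mul_coef_le0 (f : {poly int}) M : 0 < lead_coef f ->
  exists g : {poly int}, [/\ g \is monic, size g = M.+1 &
    forall i, ((size f).-1 <= i < (size f).-1 + M)%N -> (f * g)`_i <= 0].
Proof.
move=> f0; elim: M => [|M [g [g_monic g_size g_le0]]].
  by exists 1; split; rewrite ?monic1 ?size_poly1 // => i; lia.
(* [c] bounds the coefficient that ['X] moves into degree [n], and lc(f) >= 1. If [n = 0], the moved
   coefficient is 0 and [c >= 0] suffices. *)
set n := (size f).-1 in g_le0 *; pose c : int := `|(f * g)`_n.-1|.
have ltc : (size (- c%:P) < size (g * 'X)%R)%N.
  rewrite size_polyN size_mulX ?monic_neq0 // g_size.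
  by rewrite (leq_ltn_trans (size_polyC_leq1 _)).
exists (g * 'X - c%:P); split.
- by rewrite monicE lead_coefDl // lead_coefMX -monicE.
- by rewrite size_polyDl // size_mulX ?monic_neq0 // g_size.
move=> i /andP[le_n lt_n]; rewrite mulrBr mulrA coefB coefMX coefMC.
have [->|neq_n] := eqVneq i n.
  have fn : 1 <= f`_n by rewrite -lead_coefE.
  rewrite subr_le0 (@le_trans _ _ c) ?ler_peMl ?normr_ge0 //.
  by case: ifP => _; rewrite ?normr_ge0 ?ler_norm.
have lt_ni : (n < i)%N by rewrite ltn_neqAle eq_sym neq_n.
have fi : f`_i = 0 by rewrite nth_default // (leq_trans (leqSpred _)).
rewrite fi mul0r subr0; case: eqP => // /eqP i_neq0; apply: g_le0.
by lia.
Qed.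

Lemma finite_groebner_Phi1 (F : fieldType) (sigma : {rmorphism F -> F})
    (f : {poly int}) (le : rel {cmonom nat}) :
  0 < lead_coef f -> compatible_order le ->
  has_finite_sigma_groebner le (binom_ideal sigma f) -> Phi1 f.
Proof.
move=> f0 hle [s [sI sGB]].
pose M := (\max_(Q <- s) \max_(m <- msupp Q) \max_(i <- finsupp m) i)%N.
have [g [g_monic g_size g_le0]] := monic_mul_coef_le0 f M f0.
have g0 : 0 < lead_coef g by rewrite (monicP g_monic).
have fg0 : 0 < lead_coef (f * g) by rewrite lead_coefM mulr_gt0.
have LM := ybinom_LM F le (f * g) hle fg0.
have P_neq0 : ybinom F (f * g) != 0.
  rewrite -msupp_eq0; apply/fset0Pn; exists (ymon (pos_part (f * g))).
  by case: LM.
have [k [Q [mQ [mP [Qs LMQ LMP dvdP]]]]] :=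
  sGB _ (ybinom_ideal F sigma f g g0) P_neq0.
rewrite (is_LM_unique hle LMP LM) in dvdP.
move/mdivides_shiftP: dvdP => dvdP.
have [g' g'0 le_mQ] := binom_ideal_LM F sigma f hle f0 (sI _ Qs) LMQ.
(* The chain is (f g')^+ <= [mQ] <= (f g)^+ read from degree [k] on. *)
have le_coef i v : (f * g)`_(k + i) <= v%:Z -> (f * g')`_i <= v%:Z.
  rewrite -!coef_pos_part_le => le_v; apply: leq_trans (le_mQ i) _.
  by apply: leq_trans (dvdP i) _; rewrite ymonE.
have h'0 : 0 < lead_coef (f * g') by rewrite lead_coefM mulr_gt0.
pose n := (size f).-1; pose d := (size (f * g')).-1.
have f_neq0 : f != 0 by rewrite -lead_coef_eq0 gt_eqF.
have le_nd : (n <= d)%N.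
  rewrite /n /d -!subn1 leq_sub2r // dvdp_leq ?dvdp_mulr //.
  by rewrite -lead_coef_eq0 gt_eqF.
have le_dM : (d <= M)%N.
  have d_mQ : d \in finsupp mQ.
    rewrite -cmE_neq0 -lt0n ltnNge; apply/negP => mQd.
    have := leq_trans (le_mQ d) mQd.
    by rewrite coef_pos_part_le leNgt h'0.
  apply: (bigmaxn_sup_seq _ Qs) => //; case: LMQ => mQ_Q _.
  apply: (bigmaxn_sup_seq _ mQ_Q) => //.
  exact: (bigmaxn_sup_seq _ d_mQ).
have size_fg : size (f * g) = (n + M).+1.
  by rewrite size_Mmonic // g_size addnS /= -addSn prednK ?size_poly_gt0.
(* A lower [k + d] hits the nonpositive range of [f * g], a higher one exceeds its degree; both
   contradict lc(f g') > 0. *)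
have kd : (k + d = n + M)%N.
  case: (ltngtP (k + d) (n + M)) => // [lt_kd|gt_kd].
    suff: (f * g')`_d <= 0 by rewrite leNgt h'0.
    apply: (le_coef d 0%N); apply: g_le0.
    by rewrite lt_kd andbT (leq_trans le_nd) ?leq_addl.
  suff: (f * g')`_d <= 0 by rewrite leNgt h'0.
  by apply: (le_coef d 0%N); rewrite nth_default ?size_fg.
have lc_g' : lead_coef g' = 1.
  have : lead_coef (f * g') <= lead_coef f.
    rewrite -[lead_coef f]gtz0_abs //; apply: le_coef.
    rewrite -/d kd gtz0_abs //.
    have -> : (f * g)`_(n + M) = lead_coef (f * g).
      by rewrite lead_coefE size_fg.
    by rewrite lead_coefM (monicP g_monic) mulr1.
  rewrite lead_coefM -[X in _ <= X]mulr1 ler_pM2l // => le1.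
  by apply: le_anti; rewrite le1 -gtz0_ge1 g'0.
exists g'; first by rewrite monicE lc_g'.
apply/Phi0P; split=> [|i lt_i]; first exact: ltW.
(* From [k + d = n + M] and [d <= M] follows [n <= k], so [k + i] lies in [n, n + M). *)
apply: (le_coef i 0%N); apply: g_le0; rewrite -/n; move: lt_i; rewrite -/d.
lia.
Qed.

(** * From [Phi1] to a finite basis *)

Lemma Phi1_finite_groebner (F : fieldType) (sigma : {rmorphism F -> F})
    (f : {poly int}) (le : rel {cmonom nat}) :
  0 < lead_coef f -> compatible_order le ->
  Phi1 f -> has_finite_sigma_groebner le (binom_ideal sigma f).
Proof.
move=> f0 hle [g0 g0_monic /Phi0P[_ h0_le0]]; pose h0 := f * g0.
have g0_gt0 : 0 < lead_coef g0 by rewrite (monicP g0_monic).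
(* Up to degree deg [h0] only [size h0] coefficients matter, so Dickson's lemma applies. *)
have [s [sA sP]] := dickson {poly int}
  (fun i g => (pos_part (f * g))`_i)%R (size h0)
  (fun g => 0 < lead_coef g /\ (size (f * g)%R <= size h0)%N).
exists [seq ybinom F (f * g) | g <- g0 :: s]; split=> [P /mapP[g gs ->]|].
  by apply: ybinom_ideal; move: gs; rewrite inE => /orP[/eqP ->|/sA[]].
move=> P PI P_neq0; have [m LMP] := is_LM_exists hle P_neq0.
have [g g_gt0 g_le] := binom_ideal_LM F sigma f hle f0 PI LMP.
have inG g' : g' \in g0 :: s ->
    ybinom F (f * g') \in [seq ybinom F (f * g) | g <- g0 :: s].
  by move=> g's; apply/mapP; exists g'.
have LM g' : 0 < lead_coef g' ->
    is_LM le (ybinom F (f * g')) (ymon (pos_part (f * g'))).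
  by move=> g'_gt0; apply: ybinom_LM => //; rewrite lead_coefM mulr_gt0.
have [le_s|/ltnW le_s] := leqP (size (f * g)) (size h0).
  have [g' g's g'_le] := sP g (conj g_gt0 le_s).
  have [g'_gt0 g'_size] := sA g' g's.
  exists 0%N, (ybinom F (f * g')), (ymon (pos_part (f * g'))), m.
  split; [by apply: inG; rewrite inE g's orbT | exact: LM | exact: LMP |].
  apply/mdividesP => i; rewrite ymonE.
  have [/g'_le le_i|le_i] := ltnP i (size h0); first exact: leq_trans (g_le i).
  by rewrite coef_pos_part_le nth_default // (leq_trans g'_size).
(* This shift puts the top of [h0], its only positive coefficient, on the top of [f * g]. *)
exists (size (f * g)%R - size h0)%N, (ybinom F h0), (ymon (pos_part h0)), m.
split; [by apply: inG; rewrite inE eqxx | exact: LM | exact: LMP |].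
apply/mdivides_shiftP => i; rewrite ymonE coef_pos_part_le.
case: (ltngtP i (size h0).-1) => [/h0_le0 h0i|gt_i|->].
- exact: le_trans h0i _.
- by rewrite nth_default // (leq_trans (leqSpred _)).
have h0_gt0 : (0 < size h0)%N.
  by rewrite size_poly_gt0 -lead_coef_eq0 lead_coefM mulf_neq0 ?gt_eqF.
have -> : (size (f * g)%R - size h0 + (size h0).-1 = (size (f * g)%R).-1)%N.
  by rewrite -!subn1 addnBA // subnK.
(* As [g0] is monic, lc(h0) = lc(f) <= lc(f) lc(g). *)
rewrite -lead_coefE; apply: le_trans (_ : lead_coef (f * g) <= _).
  by rewrite !lead_coefM (monicP g0_monic) mulr1 ler_peMr // ltW.
by rewrite -coef_pos_part_le g_le.
Qed.

Theorem theorem3p1 (F : fieldType) (sigma : {rmorphism F -> F})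
    (f : {poly int}) (hf : 0 < lead_coef f)
    (le : rel {cmonom nat}) (hle : compatible_order le) :
  has_finite_sigma_groebner le (binom_ideal sigma f) <-> Phi1 f.
Proof.
by split; [apply: finite_groebner_Phi1|apply: Phi1_finite_groebner].
Qed.
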